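(* Let $m\ge3$ be an integer and $a,b,t$ complex numbers. Let $f_m(z,a,b)$ be the unique formal power series with $f_m=1+azf_m+bz^mf_m^2$, define $C(n,m,a,b,t)$ by $\sum_{n\ge0}C(n,m,a,b,t)z^n=\frac{f_m}{1-tzf_m}$, and let $D_1^{(m)}(N,a,b,t)=\det\big(C(i+j+1,m,a,b,t)\big)_{i,j=0}^{N-1}$. Then $$D_1^{(m)}(mn,a,b,t)=(-1)^{\binom m2n}b^{mn^2}\ (n\ge0),\qquad D_1^{(m)}(mn+1,a,b,t)=(-1)^{\binom m2n}\big(t+(n+1)a\big)b^{mn^2+2n}\ (n\ge0),$$ $$D_1^{(m)}(mn-1,a,b,t)=-(-1)^{\binom m2n}(t+na)b^{mn^2-2n}\ (n\ge1),$$ and $D_1^{(m)}(N,a,b,t)=0$ for all other $N\ge0$.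
   Context: The determinant of a $0\times0$ matrix is $1$. *)

(* Defs.v *)
From HB Require Import structures.
From mathcomp Require Import all_boot all_order all_algebra.
From mathcomp Require Import boolp reals complex.

Set Implicit Arguments.
Unset Strict Implicit.
Unset Printing Implicit Defensive.

Import Order.TTheory GRing.Theory Num.Theory.
Local Open Scope ring_scope.

(* A record, and not an alias of nat -> K, so that the Cauchy product is never
   confused with the pointwise ring structure on functions. *)
Record fps (K : Type) : Type := Fps { fps_coef : nat -> K }.

HB.instance Definition _ (K : Type) := gen_eqMixin (fps K).
HB.instance Definition _ (K : Type) := gen_choiceMixin (fps K).

Lemma fpsP (K : Type) (f g : fps K) :
  (forall n, fps_coef f n = fps_coef g n) -> f = g.
Proof. by case: f g => [f] [g] /= fg; congr Fps; apply/funext. Qed.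

Section FpsRing.
Variable K : fieldType.
Implicit Types (f g h : fps K) (c : K).

Definition fps0 : fps K := Fps (fun=> 0).
Definition fps_opp f : fps K := Fps (fun n => - fps_coef f n).
Definition fps_add f g : fps K := Fps (fun n => fps_coef f n + fps_coef g n).
Definition fpsC c : fps K := Fps (fun n => if n == 0%N then c else 0).
Definition fpsX : fps K := Fps (fun n => (n == 1%N)%:R).
Definition fps_mul f g : fps K :=
  Fps (fun n => \sum_(i < n.+1) fps_coef f i * fps_coef g (n - i)%N).

Fact fps_addA : associative fps_add.
Proof. by move=> f g h; apply: fpsP => n /=; rewrite addrA. Qed.
Fact fps_addC : commutative fps_add.
Proof. by move=> f g; apply: fpsP => n /=; rewrite addrC. Qed.
Fact fps_add0 : left_id fps0 fps_add.
Proof. by move=> f; apply: fpsP => n /=; rewrite add0r. Qed.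
Fact fps_addN : left_inverse fps0 fps_opp fps_add.
Proof. by move=> f; apply: fpsP => n /=; rewrite addNr. Qed.

HB.instance Definition _ :=
  GRing.isZmodule.Build (fps K) fps_addA fps_addC fps_add0 fps_addN.

Definition fps_trunc n f : {poly K} := \poly_(i < n) fps_coef f i.

Lemma fps_mul_trunc n f g k : (k < n)%N ->
  fps_coef (fps_mul f g) k = (fps_trunc n f * fps_trunc n g)`_k.
Proof.
move=> kn; rewrite coefM; apply: eq_bigr => i _ /=.
rewrite !coef_poly (leq_ltn_trans (leq_subr _ _) kn).
by rewrite (leq_ltn_trans _ kn) // -ltnS.
Qed.

Fact fps_mulC : commutative fps_mul.
Proof.
by move=> f g; apply: fpsP => n; rewrite !(@fps_mul_trunc n.+1) // mulrC.
Qed.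

Fact fps_mulA : associative fps_mul.
Proof.
move=> f g h; apply: fpsP => n.
transitivity (fps_trunc n.+1 f * fps_trunc n.+1 g * fps_trunc n.+1 h)`_n.
  rewrite -mulrA coefM; apply: eq_bigr => i _.
  rewrite (@fps_mul_trunc n.+1) ?ltnS ?leq_subr //.
  by rewrite coef_poly ltn_ord.
rewrite coefM; apply: eq_bigr => i _.
by rewrite (@fps_mul_trunc n.+1) // coef_poly ltnS leq_subr.
Qed.

Fact fps_mul1 : left_id (fpsC 1) fps_mul.
Proof.
move=> f; apply: fpsP => n /=.
by rewrite big_ord_recl /= subn0 mul1r big1 ?addr0 // => i _; rewrite mul0r.
Qed.

Fact fps_mulDl : left_distributive fps_mul fps_add.
Proof.
move=> f g h; apply: fpsP => n /=.
by rewrite -big_split; apply: eq_bigr => i _; rewrite mulrDl.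
Qed.

Fact fps_one_neq0 : fpsC 1 != fps0.
Proof.
by apply/eqP => /(congr1 (fun f => fps_coef f 0)) /= /eqP; rewrite oner_eq0.
Qed.

HB.instance Definition _ :=
  GRing.Zmodule_isComNzRing.Build (fps K)
    fps_mulA fps_mulC fps_mul1 fps_mulDl fps_one_neq0.

Lemma fps_coefD f g n : fps_coef (f + g) n = fps_coef f n + fps_coef g n.
Proof. by []. Qed.
Lemma fps_coefN f n : fps_coef (- f) n = - fps_coef f n.
Proof. by []. Qed.
Lemma fps_coefM f g n :
  fps_coef (f * g) n = \sum_(i < n.+1) fps_coef f i * fps_coef g (n - i)%N.
Proof. by []. Qed.
Lemma fps_coef1 n : fps_coef (1 : fps K) n = (n == 0%N)%:R.
Proof. by case: n. Qed.
Lemma fps_coefM0 f g : fps_coef (f * g) 0 = fps_coef f 0 * fps_coef g 0.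
Proof. by rewrite fps_coefM big_ord1. Qed.

Lemma fps_coefXM0 f : fps_coef (fpsX * f) 0 = 0.
Proof. by rewrite fps_coefM0 mul0r. Qed.
Lemma fps_coefXMS f n : fps_coef (fpsX * f) n.+1 = fps_coef f n.
Proof.
rewrite fps_coefM big_ord_recl mul0r add0r big_ord_recl /= mul1r subn1.
by rewrite big1 ?addr0 // => i _; rewrite mul0r.
Qed.

Lemma fps_coefCM c f n : fps_coef (fpsC c * f) n = c * fps_coef f n.
Proof.
by rewrite fps_coefM big_ord_recl subn0 big1 ?addr0 // => i _; rewrite mul0r.
Qed.

Definition fps_agree n f g := forall k, (k < n)%N -> fps_coef f k = fps_coef g k.

Definition fps_contract (Phi : fps K -> fps K) :=
  forall n f g, fps_agree n f g -> fps_agree n.+1 (Phi f) (Phi g).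

Definition fps_fix (Phi : fps K -> fps K) : fps K :=
  Fps (fun n => fps_coef (iter n.+1 Phi 0) n).

Lemma fps_fixP Phi : fps_contract Phi -> fps_fix Phi = Phi (fps_fix Phi).
Proof.
move=> ctr.
have agr n : fps_agree n (iter n Phi 0) (iter n.+1 Phi 0).
  by elim: n => [|n IH] //; apply: ctr.
have agr_le n d : fps_agree n (iter n Phi 0) (iter (n + d) Phi 0).
  elim: d => [|d IH] k kn; first by rewrite addn0.
  by rewrite IH // addnS agr // (leq_trans kn) // leq_addr.
apply: fpsP => n /=; apply: (ctr n) => // k kn.
by rewrite -(subnKC kn) -(agr_le k.+1).
Qed.

Lemma fps_fix_uniq Phi f g :
  fps_contract Phi -> f = Phi f -> g = Phi g -> f = g.
Proof.
move=> ctr ff gg; suff agr n : fps_agree n f g.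
  by apply: fpsP => n; apply: (agr n.+1).
by elim: n => [|n IH] //; rewrite ff gg; apply: ctr.
Qed.

Definition fps_unit : {pred fps K} := fun f => fps_coef f 0 != 0.

(* The inverse of f is the fixed point of
   g |-> f(0)^-1 (1 - (f - f(0)) g). *)
Definition fps_inv f : fps K :=
  if fps_unit f then
    fps_fix (fun g => fpsC (fps_coef f 0)^-1 * (1 - (f - fpsC (fps_coef f 0)) * g))
  else f.

Lemma fps_agreeM n f g h :
  fps_coef h 0 = 0 -> fps_agree n f g -> fps_agree n.+1 (h * f) (h * g).
Proof.
move=> h0 fg k; rewrite ltnS => kn; rewrite !fps_coefM.
rewrite big_ord_recl [RHS]big_ord_recl h0 !mul0r; congr (_ + _).
apply: eq_bigr => i _; congr (_ * _); apply: fg.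
by apply: leq_trans kn; rewrite /= ltn_subrL (leq_ltn_trans _ (ltn_ord i)).
Qed.

Fact fps_mulV : {in fps_unit, left_inverse 1 fps_inv *%R}.
Proof.
move=> f uf; have f0 : fps_coef f 0 != 0 := uf.
rewrite /fps_inv (uf : fps_unit f = true).
set c := fps_coef f 0; set Phi := fun _ => _.
have ctr : fps_contract Phi.
  move=> n g h gh k kn; rewrite /Phi !fps_coefCM !fps_coefD !fps_coefN.
  congr (_ * (_ - _)); apply: (fps_agreeM _ gh) => //.
  by rewrite fps_coefD fps_coefN subrr.
have cc : fpsC c * fpsC c^-1 = 1.
  apply: fpsP => n; rewrite fps_coefCM fps_coef1 /=.
  by case: n => [|n] /=; rewrite ?mulr0 ?mulfV.
move: (fps_fixP ctr); set g := fps_fix Phi => /(congr1 ( *%R (fpsC c))).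
rewrite /Phi mulrA cc mul1r mulrBl opprB addrCA -{1}[_ * g]addr0.
by move/addrI/esym/eqP; rewrite subr_eq0 mulrC => /eqP ->.
Qed.

Fact fps_unitPl f g : g * f = 1 -> fps_unit f.
Proof.
move=> /(congr1 (fun h => fps_coef h 0)) /=; rewrite -/(g * f) big_ord1 => gf.
by apply/eqP => f0; move/eqP: gf; rewrite /= f0 mulr0 eq_sym oner_eq0.
Qed.

Fact fps_inv_out : {in [predC fps_unit], fps_inv =1 id}.
Proof. by move=> f /negbTE uf; rewrite /fps_inv (uf : fps_unit f = false). Qed.

HB.instance Definition _ :=
  GRing.ComNzRing_hasMulInverse.Build (fps K) fps_mulV fps_unitPl fps_inv_out.

Lemma fps_denom_unit (t : K) f : 1 - fpsC t * fpsX * f \is a GRing.unit.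
Proof.
suff: fps_unit (1 - fpsC t * fpsX * f) by [].
rewrite /fps_unit fps_coefD fps_coefN -mulrA fps_coefCM fps_coefXM0.
by rewrite mulr0 subr0 fps_coef1 oner_eq0.
Qed.

Lemma fm_exists_unique (m : nat) (a b : K) : (0 < m)%N ->
  exists! f : fps K,
    f = 1 + fpsC a * fpsX * f + fpsC b * fpsX ^+ m * f ^+ 2.
Proof.
move=> m0.
pose Phi f : fps K := 1 + fpsC a * fpsX * f + fpsC b * fpsX ^+ m * f ^+ 2.
have ctr : fps_contract Phi.
  move=> n f g fg k kn; rewrite /Phi !fps_coefD; congr (_ + _ + _).
    by apply: (fps_agreeM _ fg) kn; rewrite fps_coefCM mulr0.
  apply: (@fps_agreeM n) kn.
    by rewrite fps_coefCM -(prednK m0) exprS fps_coefXM0 mulr0.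
  move=> i ni; rewrite !expr2 !fps_coefM; apply: eq_bigr => j _.
  rewrite !fg //; first exact: leq_ltn_trans (leq_subr _ _) ni.
  by apply: leq_ltn_trans ni; rewrite -ltnS.
exists (fps_fix Phi); split; first exact: fps_fixP.
by move=> g gE; apply: (fps_fix_uniq ctr) => //; apply: fps_fixP.
Qed.

(* [f] stands for the series f_m(z,a,b), through which the coefficients
   C(n,m,a,b,t) depend on m, a and b. *)
Definition C (f : fps K) (t : K) (n : nat) : K :=
  fps_coef (f / (1 - fpsC t * fpsX * f)) n.

Definition D1 (f : fps K) (t : K) (N : nat) : K :=
  \det (\matrix_(i < N, j < N) C f t (i + j + 1)%N).

End FpsRing.

Arguments fpsC {K} c.
Arguments fpsX {K}.

(* Main.v *)
(** Write [H_h] for the Hankel matrix [(h_(i+j+1))], whose generating function is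
    [(h(x) - h(y)) / (x - y)].  Multiplying this kernel by [u(x) u(y)], where
    [u(0) = 1], changes no leading principal minor.  Since [1/F = 1/f - tz] for
    [F = f/(1 - tzf)] and [1/f = 1 - az - b z^m f], taking [u = 1/F] turns [H_F]
    into [b H_(z^m f)] plus [t + a] in the corner, so that
    [D1(N+1) = b^(N+1) det_(N+1) H_(z^m f) + (t+a) b^N det_N H_(z^(m-2) f)].
    For [p + q = m] and [p > 0], taking [u = 1/f] turns [H_(z^p f)] into the
    direct sum of an anti-triangular [p x p] block and [b H_(z^q f)].  The cases
    [p = m], [m - 2] and [2] give recurrences which lower [N] by [m]. *)
Require Import Defs.
From mathcomp Require Import all_boot all_order all_algebra.
From mathcomp Require Import boolp reals complex.
From mathcomp Require Import ring zify.

Import Order.TTheory GRing.Theory Num.Theory.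
Local Open Scope ring_scope.

(** * Infinite matrices, multiplication by power series, and leading minors *)

Section InfiniteMatrices.
Context {K : fieldType}.
Implicit Types (M P : nat -> nat -> K) (u v h : fps K).

(** With [M] read as the series sum of [M i j] x^i y^j, [rowmul u] is multiplication by u(x) and
    [colmul u] multiplication by u(y). *)
Definition rowmul u M i j : K := fps_coef (Fps (M^~ j) * u) i.
Definition colmul u M i j : K := rowmul u (fun i j => M j i) j i.
Definition outer u v i j : K := fps_coef u i * fps_coef v j.
Definition hankel h i j : K := fps_coef h (i + j + 1).
Definition minor N M : K := \det (\matrix_(i < N, j < N) M i j).

(* Multiplication of the generating function by [x - y]. *)
Definition displacement M i j : K := rowmul fpsX M i j - colmul fpsX M i j.

Lemma infmxP M P : (forall i j, M i j = P i j) -> M = P.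
Proof. by move=> MP; apply/funext => i; apply/funext. Qed.

Lemma minor_tr N M : minor N (fun i j => M j i) = minor N M.
Proof. by rewrite /minor -det_tr; congr (\det _); apply/matrixP=> i j; rewrite !mxE. Qed.

(** [rowmul u] is left multiplication by the lower triangular Toeplitz matrix of [u], which has unit
    diagonal and acts within the first [N] rows. *)
Lemma minor_rowmul u M N :
  fps_coef u 0 = 1 -> minor N (rowmul u M) = minor N M.
Proof.
move=> u0; pose L := \matrix_(i < N, k < N)
  (if (k <= i)%N then fps_coef u (i - k) else 0).
suff -> : minor N (rowmul u M) = \det (L *m \matrix_(i < N, j < N) M i j).
  rewrite det_mulmx det_trig; last first.
    by apply/is_trig_mxP => i j ij; rewrite mxE leqNgt ij.
  by rewrite big1 ?mul1r // => i _; rewrite mxE leqnn subnn.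
congr (\det _); apply/matrixP => i j; rewrite !mxE /rowmul fps_coefM.
rewrite (big_ord_widen_cond N predT
  (fun k => M k j * fps_coef u (i - k))) ?ltn_ord //= big_mkcond /=.
apply: eq_bigr => k _; rewrite !mxE ltnS.
by case: ifP => _; rewrite ?mul0r // mulrC.
Qed.

Lemma minor_colmul u M N :
  fps_coef u 0 = 1 -> minor N (colmul u M) = minor N M.
Proof.
move=> u0; rewrite -[RHS]minor_tr -[RHS](minor_rowmul u) //.
exact: (minor_tr N (rowmul u (fun i j => M j i))).
Qed.

Lemma rowmul_lin u M P c :
  rowmul u (fun i j => M i j + c * P i j)
  = (fun i j => rowmul u M i j + c * rowmul u P i j).
Proof.
apply: infmxP => i j; rewrite /rowmul !fps_coefM mulr_sumr -big_split /=.
by apply: eq_bigr => k _; ring.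
Qed.

Lemma colmul_lin u M P c :
  colmul u (fun i j => M i j + c * P i j)
  = (fun i j => colmul u M i j + c * colmul u P i j).
Proof. by apply: infmxP => i j; rewrite /colmul rowmul_lin. Qed.

Lemma rowmul_rowmul u v M : rowmul u (rowmul v M) = rowmul (u * v) M.
Proof.
apply: infmxP => i j; rewrite /rowmul.
have -> : Fps (fun k => fps_coef (Fps (M^~ j) * v) k) = Fps (M^~ j) * v.
  exact: fpsP.
by rewrite -mulrA [v * u]mulrC.
Qed.

Lemma rowmul_colmul u v M : rowmul u (colmul v M) = colmul v (rowmul u M).
Proof.
apply: infmxP => i j; rewrite /colmul /rowmul !fps_coefM.
under eq_bigr do rewrite /= mulr_suml.
under [RHS]eq_bigr do rewrite /= mulr_suml.
rewrite exchange_big /=; apply: eq_bigr => k _; apply: eq_bigr => l _.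
by rewrite mulrAC.
Qed.

Lemma rowmul_outer u v w : rowmul u (outer v w) = outer (u * v) w.
Proof.
apply: infmxP => i j; rewrite /rowmul /outer [u * v]mulrC !fps_coefM mulr_suml.
by apply: eq_bigr => k _ /=; rewrite mulrAC.
Qed.

Lemma colmul_outer u v w : colmul u (outer v w) = outer v (u * w).
Proof.
apply: infmxP => i j; transitivity (rowmul u (outer w v) j i).
  by congr (rowmul u _ j i); apply: infmxP => k l; rewrite /outer mulrC.
by rewrite rowmul_outer /outer mulrC.
Qed.

Lemma fps_coefXnM p h i :
  fps_coef (fpsX ^+ p * h) i = if (i < p)%N then 0 else fps_coef h (i - p).
Proof.
elim: p i => [|p IH] i; first by rewrite mul1r subn0.
rewrite exprS -mulrA; case: i => [|i]; first exact: fps_coefXM0.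
by rewrite fps_coefXMS IH ltnS.
Qed.

Lemma fps_coefXn p i : fps_coef (fpsX ^+ p : fps K) i = (i == p)%:R.
Proof.
rewrite -[fpsX ^+ p]mulr1 fps_coefXnM fps_coef1 subn_eq0.
by case: ltngtP.
Qed.

Lemma rowmulXn p M i j :
  rowmul (fpsX ^+ p) M i j = if (i < p)%N then 0 else M (i - p)%N j.
Proof. by rewrite /rowmul mulrC fps_coefXnM. Qed.

Lemma colmulXn p M i j :
  colmul (fpsX ^+ p) M i j = if (j < p)%N then 0 else M i (j - p)%N.
Proof. exact: rowmulXn. Qed.

(** * Displacement of Hankel matrices *)

Lemma displacementE M i j :
  displacement M i j
  = (if i is i'.+1 then M i' j else 0) - (if j is j'.+1 then M i j' else 0).
Proof.
rewrite /displacement -[fpsX]expr1 rowmulXn colmulXn.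
by case: i => [|i]; case: j => [|j]; rewrite ?subn1.
Qed.

(** Each row of [M] is recovered from the displacement and the row above it. Matrix identities can
    therefore be checked after multiplication by x - y, where the Hankel kernels lose their
    denominator. *)
Lemma displacement_inj : injective displacement.
Proof.
move=> M P MP; apply: infmxP => i; elim: i => [|i IH] j.
  have := congr1 (fun Q => Q 0%N j.+1) MP; rewrite /= !displacementE.
  by rewrite !sub0r => /oppr_inj.
have := congr1 (fun Q => Q i.+1 j.+1) MP; rewrite /= !displacementE IH.
by move/addrI/oppr_inj.
Qed.

Lemma displacement_lin M P c :
  displacement (fun i j => M i j + c * P i j)
  = (fun i j => displacement M i j + c * displacement P i j).
Proof.
by apply: infmxP => i j; rewrite /displacement rowmul_lin colmul_lin; ring.
Qed.

Lemma displacement_rowmul u M :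
  displacement (rowmul u M) = rowmul u (displacement M).
Proof.
have -> : displacement M = fun i j => rowmul fpsX M i j + (-1) * colmul fpsX M i j.
  by apply: infmxP => i j; rewrite mulN1r.
rewrite rowmul_lin rowmul_rowmul rowmul_colmul mulrC -rowmul_rowmul.
by apply: infmxP => i j; rewrite mulN1r.
Qed.

(** Transposition exchanges [rowmul] and [colmul] and changes the sign of the displacement. *)
Lemma displacement_colmul u M :
  displacement (colmul u M) = colmul u (displacement M).
Proof.
apply: infmxP => i j.
transitivity (- displacement (rowmul u (fun i j => M j i)) j i).
  by rewrite /displacement opprB.
rewrite displacement_rowmul -mulN1r /colmul.
have -> : (fun i j => displacement M j i)
  = (fun i j => 0 + -1 * displacement (fun i j => M j i) i j).
  by apply: infmxP => k l; rewrite add0r mulN1r /displacement opprB.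
rewrite rowmul_lin -[LHS]add0r; congr (_ + _).
by rewrite /rowmul fps_coefM big1 // => k _; rewrite mul0r.
Qed.

Lemma displacement_hankel h :
  displacement (hankel h) = (fun i j => outer h 1 i j + (-1) * outer 1 h i j).
Proof.
apply: infmxP => i j; rewrite displacementE /outer /hankel !fps_coef1 mulN1r.
case: i => [|i]; case: j => [|j]; rewrite /= ?mulr1 ?mul1r ?mulr0 ?mul0r ?addn0 ?addn1 ?add0n ?subrr //.
by rewrite addnS addSn subrr.
Qed.

Lemma displacement_mul_hankel u v h :
  displacement (rowmul u (colmul v (hankel h)))
  = (fun i j => outer (u * h) v i j + (-1) * outer u (v * h) i j).
Proof.
rewrite displacement_rowmul displacement_colmul displacement_hankel.
by rewrite colmul_lin rowmul_lin !colmul_outer !rowmul_outer !mulr1.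
Qed.

(** Here u(x) u(y) (h(x) - h(y)) = u(y) - u(x). *)
Lemma mul_hankel_inv u h : u * h = 1 ->
  rowmul u (colmul u (hankel h)) = hankel (- u).
Proof.
move=> uh; apply: displacement_inj.
rewrite displacement_mul_hankel displacement_hankel uh.
by apply: infmxP => i j; rewrite /outer !fps_coefN; ring.
Qed.

Lemma minor_hankel_inv u h N : fps_coef u 0 = 1 -> u * h = 1 ->
  minor N (hankel h) = minor N (hankel (- u)).
Proof.
by move=> u0 uh; rewrite -(mul_hankel_inv _ _ uh) minor_rowmul // minor_colmul.
Qed.

(** * Determinant evaluations *)

Lemma minorZ N c M : minor N (fun i j => c * M i j) = c ^+ N * minor N M.
Proof.
by rewrite /minor -detZ; congr (\det _); apply/matrixP => i j; rewrite !mxE.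
Qed.

(** The determinant is linear in row 0, and [c] enters only the first entry of that row. *)
Lemma minor_corner N c M P :
  (forall i j, M i j = (if (i + j == 0)%N then c else 0) + P i j) ->
  minor N.+1 M = minor N.+1 P + c * minor N (fun i j => P i.+1 j.+1).
Proof.
move=> MP.
have -> : minor N (fun i j => P i.+1 j.+1)
        = cofactor (\matrix_(i < N.+1, j < N.+1) P i j) ord0 ord0.
  rewrite /cofactor expr0 mul1r; congr (\det _).
  by apply/matrixP => i k; rewrite !mxE.
rewrite /minor (expand_det_row _ ord0).
rewrite [X in _ = X + _](expand_det_row _ ord0).
have cof j : cofactor (\matrix_(i < N.+1, j < N.+1) M i j) ord0 j
           = cofactor (\matrix_(i < N.+1, j < N.+1) P i j) ord0 j.
  rewrite /cofactor; congr (_ * \det _); apply/matrixP => i k.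
  by rewrite !mxE MP add0r.
rewrite !big_ord_recl cof !mxE MP /= mulrDl -addrA addrC; congr (_ + _ + _).
by apply: eq_bigr => k _; rewrite cof !mxE MP add0r.
Qed.

Lemma minor_direct_sum p k M P Q :
  (forall i j, (i < p)%N -> (j < p)%N -> M i j = P i j) ->
  (forall i j, (i < p)%N -> M i (p + j)%N = 0) ->
  (forall i j, M (p + i)%N (p + j)%N = Q i j) ->
  minor (p + k) M = minor p P * minor k Q.
Proof.
move=> ul ur dr; rewrite /minor -[RHS](det_lblock _
  (\matrix_(i < k, j < p) M (p + i)%N j)); congr (\det _).
apply/matrixP => i j; rewrite mxE.
case: (splitP i) => i' iE; case: (splitP j) => j' jE; rewrite iE jE.
- have -> : i = lshift k i' by apply: val_inj.
  have -> : j = lshift k j' by apply: val_inj.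
  by rewrite block_mxEul mxE ul.
- have -> : i = lshift k i' by apply: val_inj.
  have -> : j = rshift p j' by apply: val_inj.
  by rewrite block_mxEur mxE ur.
- have -> : i = rshift p i' by apply: val_inj.
  have -> : j = lshift k j' by apply: val_inj.
  by rewrite block_mxEdl mxE.
- have -> : i = rshift p i' by apply: val_inj.
  have -> : j = rshift p j' by apply: val_inj.
  by rewrite block_mxEdr mxE dr.
Qed.

(** Row 0 is nonzero only in its last column. Expanding there at size p + 1 leaves the same matrix
    of size p with sign (-1)^p, and C(p+1, 2) = C(p, 2) + p. *)
Lemma minor_antidiag p c :
  minor p (fun i j => (i + j + 1 == p)%N%:R + c * (i + j == p)%N%:R)
  = (-1) ^+ 'C(p, 2).
Proof.
elim: p => [|p IH]; first by rewrite /minor det_mx00.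
rewrite /minor (expand_det_row _ ord0) big_ord_recr big1 => [|i _]; last first.
  rewrite mxE /= ?add0n addn1 eqSS !ltn_eqF ?mulr0 ?addr0 ?mul0r //.
  by rewrite ltnS ltnW.
rewrite /= add0r mxE /= ?add0n addn1 eqxx ltn_eqF // mulr0 addr0 mul1r.
rewrite /cofactor /= ?add0n binS bin1 addnC exprD -IH; congr (_ * \det _).
apply/matrixP => i j; rewrite !mxE /= /bump /= leqNgt ltn_ord add0n add1n.
by rewrite !addSn !eqSS addn1.
Qed.

Lemma minor_row0 N M : (forall j, (j < N.+1)%N -> M 0%N j = 0) -> minor N.+1 M = 0.
Proof.
move=> M0; rewrite /minor (expand_det_row _ ord0) big1 // => j _.
by rewrite mxE M0 ?mul0r.
Qed.

End InfiniteMatrices.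

(** * Hankel determinants of the series x^p f *)

Section QuadraticSeries.
Context {K : fieldType}.
Variables (m : nat) (a b : K) (f : fps K).
Hypothesis m0 : (0 < m)%N.
Hypothesis hf : f = 1 + fpsC a * fpsX * f + fpsC b * fpsX ^+ m * f ^+ 2.

(** This is 1/f, read off from the equation for [f] after division by [f]. *)
Let g : fps K := 1 - fpsC a * fpsX - fpsC b * (fpsX ^+ m * f).

Let gf : g * f = 1.
Proof.
transitivity (f - (fpsC a * fpsX * f + fpsC b * fpsX ^+ m * f ^+ 2)).
  by rewrite /g; ring.
by rewrite {1}hf; ring.
Qed.

Let g0 : fps_coef g 0 = 1.
Proof.
rewrite /g !fps_coefD !fps_coefN !fps_coefCM fps_coef1 fps_coefXnM m0.
by rewrite !mulr0 !subr0.
Qed.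

Definition hdet p N : K := minor N (hankel (fpsX ^+ p * f)).

Lemma hdet0 p : hdet p 0 = 1.
Proof. exact: det_mx00. Qed.

Lemma hdet_small p N : (0 < N < p)%N -> hdet p N = 0.
Proof.
case: N => // N Np; apply: minor_row0 => j jN.
by rewrite /hankel fps_coefXnM add0n addn1 (leq_ltn_trans jN).
Qed.

(** Multiplied by g(x) g(y), the numerator of the kernel becomes x^p g(y) - y^p g(x), that is, (x^p
    - y^p) - a xy (x^(p-1) - y^(p-1)) + b (xy)^p (x^q f(x) - y^q f(y)). *)
Lemma hdet_reduce p q k : (0 < p)%N -> (p + q)%N = m ->
  hdet p (p + k) = (-1) ^+ 'C(p, 2) * b ^+ k * hdet q k.
Proof.
move=> p0 pq.
rewrite /hdet -(minor_colmul g) // -(minor_rowmul g) //.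
pose h : fps K := fpsX ^+ q * f.
(* Multiplication by (xy)^l, which moves a matrix [l] places down the diagonal. *)
pose shift l M : nat -> nat -> K := rowmul (fpsX ^+ l) (colmul (fpsX ^+ l) M).
have -> : rowmul g (colmul g (hankel (fpsX ^+ p * f)))
  = fun i j => hankel (fpsX ^+ p) i j + - a * shift 1%N (hankel (fpsX ^+ p.-1)) i j
               + b * shift p (hankel h) i j.
  apply: displacement_inj; rewrite !displacement_lin !displacement_mul_hankel.
  rewrite displacement_hankel; apply: infmxP => i j; rewrite /outer.
  rewrite [g * _]mulrCA gf mulr1 expr1 -exprS prednK // /h mulrA -exprD pq.
  rewrite !fps_coefD !fps_coefN !fps_coefCM; ring.
rewrite -mulrA -(minor_antidiag p (- a)) -minorZ.
apply: minor_direct_sum => i j.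
- move=> ip jp; rewrite /shift !rowmulXn !colmulXn ip mulr0 addr0.
  rewrite /hankel !fps_coefXn; congr (_ + _ * _).
  (* Row 0 and column 0 of the shifted summand vanish; i + j = p is impossible there because i, j <
     p. *)
  case: i ip => [|i] ip /=; first by rewrite add0n ltn_eqF.
  case: j jp => [|j] jp /=; first by rewrite addn0 ltn_eqF.
  by congr (nat_of_bool _)%:R; lia.
- move=> ip; rewrite /shift !rowmulXn !colmulXn ip mulr0 addr0.
  rewrite /hankel !fps_coefXn.
  have -> : (i + (p + j) + 1 == p)%N = false by lia.
  rewrite add0r; case: i ip => [|i] ip /=; first by rewrite mulr0.
  case: ifP => _; first by rewrite mulr0.
  have -> : (i.+1 - 1 + (p + j - 1) + 1 == p.-1)%N = false by lia.
  by rewrite mulr0.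
rewrite /shift !rowmulXn !colmulXn /hankel !fps_coefXn.
rewrite !ltnNge !leq_addr !addKn /=.
have -> : (p + i + (p + j) + 1 == p)%N = false by lia.
have -> : (p + i - 1 + (p + j - 1) + 1 == p.-1)%N = false by lia.
by rewrite !if_same !mulr0 !add0r.
Qed.

Lemma D1_hdet t N : (1 < m)%N ->
  D1 f t N.+1 = b ^+ N.+1 * hdet m N.+1 + (t + a) * b ^+ N * hdet (m - 2) N.
Proof.
move=> m2; pose u := (1 - fpsC t * fpsX * f) * g.
have uF : u * (f / (1 - fpsC t * fpsX * f)) = 1.
  by rewrite /u [_ * g]mulrC mulrACA gf mul1r mulrV // fps_denom_unit.
have uE : u = g - fpsC t * fpsX.
  by rewrite /u mulrBl mul1r -[_ * f * g]mulrA [f * g]mulrC gf mulr1.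
have u0 : fps_coef u 0 = 1.
  by rewrite uE fps_coefD g0 fps_coefN fps_coefCM mulr0 subr0.
rewrite [LHS](_ : _ = minor N.+1 (hankel (f / (1 - fpsC t * fpsX * f)))) //.
rewrite (minor_hankel_inv _ _ _ u0 uF).
(* Since -u = -1 + (t + a) z + b z^m f and Hankel entries start at coefficient 1, the constant drops
   out and t + a stands only in the corner. *)
rewrite (@minor_corner _ _ (t + a) _
  (fun i j => b * hankel (fpsX ^+ m * f) i j)) => [|i j]; last first.
  rewrite /hankel uE /g !(fps_coefN, fps_coefD, fps_coefCM) fps_coef1 addn1 /=.
  by case: (i + j)%N => [|k] /=; ring.
rewrite !minorZ -mulrA; congr (_ + _ * (_ * _)).
(* Deleting row and column 0 raises the coefficient index by 2, which turns x^m f into x^(m-2) f. *)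
congr (minor N _); apply: infmxP => i j; rewrite /hankel !fps_coefXnM.
have -> : (i.+1 + j.+1 + 1 < m)%N = (i + j + 1 < m - 2)%N by lia.
by case: ifP => // _; congr fps_coef; lia.
Qed.

Lemma D1_t0 N : D1 f 0 N = hdet 0 N.
Proof.
congr (\det _); apply/matrixP => i j; rewrite !mxE /C /hankel mul1r.
have -> : fpsC 0 = 0 :> fps K by apply: fpsP => -[].
by rewrite !mul0r subr0 divr1.
Qed.

(** * Recurrences of period [m] and their solutions *)

Hypothesis hm : (2 < m)%N.

Let s : K := (-1) ^+ 'C(m, 2).

(** C(m, 2) - C(m-2, 2) = 2m - 3 is odd. *)
Let sE : s = - (-1) ^+ 'C(m - 2, 2).
Proof.
rewrite /s; have [k ->] : exists k, m = k.+2 by exists (m - 2)%N; lia.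
rewrite subSS subSS subn0 !binS !bin1 !bin0 -addnA !exprD exprS.
transitivity (- (-1) ^+ 'C(k, 2) * ((-1) ^+ k) ^+ 2 : K); first by ring.
by rewrite sqrr_sign mulr1.
Qed.

(** Two reductions in turn, with (p, q) = (m - 2, 2) and then (2, m - 2). *)
Lemma hdet_period k :
  hdet (m - 2) (m + k) = s * b ^+ (2 * k + 2) * hdet (m - 2) k.
Proof.
have -> : (m + k = m - 2 + (2 + k))%N by lia.
rewrite (hdet_reduce _ 2) ?(hdet_reduce 2 (m - 2)); [|lia..].
by rewrite sE mul2n -addnn !exprD; ring.
Qed.

Lemma hdet_mul n : hdet (m - 2) (m * n) = s ^+ n * b ^+ (m * n * n.-1 + 2 * n).
Proof.
elim: n => [|n IH]; first by rewrite !muln0 hdet0 mulr1.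
rewrite mulnS hdet_period IH exprS mulrACA -exprD; congr (_ * b ^+ _).
by case: n {IH} => [|n]; nia.
Qed.

Lemma hdet_mul_sub2 n :
  hdet (m - 2) (m * n + (m - 2))
  = - s ^+ n.+1 * b ^+ (n * (m * n + (m - 2))).
Proof.
elim: n => [|n IH].
  (* At size m - 2 the anti-triangular block is the whole matrix. *)
  rewrite muln0 -{2}[(m - 2)%N]addn0 (hdet_reduce _ 2) ?subn_gt0 //; last by lia.
  by rewrite hdet0 sE !mulr1 expr1 opprK.
rewrite mulnS -addnA hdet_period IH [s ^+ n.+2]exprS !mulNr mulrN mulrACA -exprD.
by congr (- (_ * b ^+ _)); nia.
Qed.

Lemma hdet_eq0 n r : (0 < r < m)%N -> r != (m - 2)%N ->
  hdet (m - 2) (m * n + r) = 0.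
Proof.
move=> rm rm2; elim: n => [|n IH]; last by rewrite mulnS -addnA hdet_period IH mulr0.
rewrite muln0 add0n; have [r_small|] := ltnP r (m - 2); first by rewrite hdet_small //; lia.
(* The residue m - 1 reduces to the 1 x 1 determinant of x^2 f, which is 0. *)
move=> rge; have -> : r = (m - 2 + 1)%N by lia.
rewrite (hdet_reduce _ 2) ?subn_gt0 //; last by lia.
by rewrite (hdet_small 2) ?mulr0.
Qed.

Lemma D1_small t N : (N.+1 < m)%N ->
  D1 f t N.+1 = (t + a) * b ^+ N * hdet (m - 2) N.
Proof.
by move=> Nm; rewrite D1_hdet ?(ltnW hm) // hdet_small // mulr0 add0r.
Qed.

(** Reduction with p = m, q = 0 lands on [f] itself, hence on [D1] at t = 0. The inductions below
    therefore quantify over [t] and use their hypothesis at 0. *)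
Lemma D1_period t k :
  D1 f t (m + k) = s * b ^+ (2 * k + m) * D1 f 0 k
                   + (t + a) * b ^+ (m + k).-1 * hdet (m - 2) (m + k).-1.
Proof.
have mk : (m + k = (m + k).-1.+1)%N by lia.
rewrite {1}mk D1_hdet ?(ltnW hm) // -mk (hdet_reduce m 0) // ?addn0 //.
by rewrite /s -D1_t0 mul2n -addnn !exprD; ring.
Qed.

Lemma D1_mul n t : D1 f t (m * n) = s ^+ n * b ^+ (m * n ^ 2).
Proof.
elim: n t => [|n IH] t; first by rewrite !muln0 mulr1; exact: det_mx00.
have E : (m + m * n).-1 = (m * n + (m - 1))%N by lia.
(* The second term has size congruent to m - 1 and vanishes. *)
rewrite mulnS D1_period IH E hdet_eq0; [|lia..].
by rewrite mulr0 addr0 mulrACA -exprS -exprD; congr (_ * b ^+ _); nia.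
Qed.

Lemma D1_mul_add1 n t :
  D1 f t (m * n + 1)
  = s ^+ n * (t + (n + 1)%:R * a) * b ^+ (m * n ^ 2 + 2 * n).
Proof.
elim: n t => [|n IH] t.
  by rewrite exp0n // !muln0 !add0n D1_small ?(ltnW hm) // hdet0 !expr0 mul1r !mulr1 mul1r.
have E : (m + (m * n + 1)).-1 = (m * n.+1)%N by nia.
rewrite {1}mulnS -addnA D1_period IH E hdet_mul.
have -> : s * b ^+ (2 * (m * n + 1) + m)
    * (s ^+ n * (0 + (n + 1)%:R * a) * b ^+ (m * n ^ 2 + 2 * n))
  = s ^+ n.+1 * ((n + 1)%:R * a)
    * (b ^+ (2 * (m * n + 1) + m) * b ^+ (m * n ^ 2 + 2 * n)).
  by rewrite exprS; ring.
have -> : (t + a) * b ^+ (m * n.+1)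
    * (s ^+ n.+1 * b ^+ (m * n.+1 * n.+1.-1 + 2 * n.+1))
  = s ^+ n.+1 * (t + a) * (b ^+ (m * n.+1) * b ^+ (m * n.+1 * n + 2 * n.+1)).
  by rewrite /=; ring.
rewrite -!exprD.
have -> : (2 * (m * n + 1) + m + (m * n ^ 2 + 2 * n) = m * n.+1 ^ 2 + 2 * n.+1)%N.
  by nia.
have -> : (m * n.+1 + (m * n.+1 * n + 2 * n.+1) = m * n.+1 ^ 2 + 2 * n.+1)%N by nia.
(* Both terms carry the same power of [b]; the hypothesis at t = 0 gives (n + 1) a, and the second
   term adds t + a. *)
by rewrite -mulrDl -mulrDr addn1 -natr1; ring.
Qed.

Lemma D1_mul_sub1 n t :
  D1 f t (m * n + (m - 1))
  = - s ^+ n.+1 * (t + n.+1%:R * a) * b ^+ (m * n.+1 ^ 2 - 2 * n.+1).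
Proof.
elim: n t => [|n IH] t.
  have E : (m - 1 = (m - 2).+1)%N by lia.
  rewrite muln0 add0n E D1_small; last by lia.
  have := hdet_mul_sub2 0; rewrite muln0 add0n mul0n mulr1 => ->.
  have -> : (m * 1 ^ 2 - 2 * 1 = m - 2)%N by lia.
  by ring.
have E : (m + (m * n + (m - 1))).-1 = (m * n.+1 + (m - 2))%N by nia.
rewrite {1}mulnS -addnA D1_period IH E hdet_mul_sub2.
have -> : s * b ^+ (2 * (m * n + (m - 1)) + m)
    * (- s ^+ n.+1 * (0 + n.+1%:R * a) * b ^+ (m * n.+1 ^ 2 - 2 * n.+1))
  = - s ^+ n.+2 * (n.+1%:R * a)
    * (b ^+ (2 * (m * n + (m - 1)) + m) * b ^+ (m * n.+1 ^ 2 - 2 * n.+1)).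
  by rewrite [s ^+ n.+2]exprS; ring.
set e := (n.+1 * _)%N.
have -> : (t + a) * b ^+ (m * n.+1 + (m - 2)) * (- s ^+ n.+2 * b ^+ e)
  = - s ^+ n.+2 * (t + a) * (b ^+ (m * n.+1 + (m - 2)) * b ^+ e).
  by ring.
rewrite -!exprD /e.
(* Writing m = k + 2 replaces the truncated subtraction in the exponent by a polynomial. *)
have [k mE] : exists k, m = k.+2 by exists (m - 2)%N; lia.
have sq l : (m * l.+1 ^ 2 - 2 * l.+1 = (k * l.+1 + 2 * l) * l.+1)%N.
  by rewrite mE; nia.
rewrite !sq.
have -> : (2 * (m * n + (m - 1)) + m + (k * n.+1 + 2 * n) * n.+1
           = (k * n.+2 + 2 * n.+1) * n.+2)%N by nia.
have -> : (m * n.+1 + (m - 2) + n.+1 * (m * n.+1 + (m - 2))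
           = (k * n.+2 + 2 * n.+1) * n.+2)%N by nia.
by rewrite -mulrDl -mulrDr -[n.+2%:R]natr1; ring.
Qed.

(** The second term of [D1_period] has residue r - 1, strictly between 0 and m - 2, so it vanishes
    at every stage. *)
Lemma D1_eq0 n r t : (1 < r < m - 1)%N -> D1 f t (m * n + r) = 0.
Proof.
move=> rm; elim: n t => [|n IH] t.
  have -> : (m * 0 + r = r.-1.+1)%N by lia.
  by rewrite D1_small ?hdet_small ?mulr0 //; lia.
have E : (m + (m * n + r)).-1 = (m * n.+1 + r.-1)%N by nia.
rewrite {1}mulnS -addnA D1_period IH E hdet_eq0 ?mulr0 ?addr0 //; lia.
Qed.

End QuadraticSeries.

Theorem theorem7p3 (R : realType) (m : nat) (a b t : R[i]) (f : fps R[i])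
  (hm : (3 <= m)%N)
  (hf : f = 1 + fpsC a * fpsX * f + fpsC b * fpsX ^+ m * f ^+ 2) :
  [/\ forall n : nat,
        D1 f t (m * n)%N = (-1) ^+ ('C(m, 2) * n)%N * b ^+ (m * n ^ 2)%N,
      forall n : nat,
        D1 f t (m * n + 1)%N
        = (-1) ^+ ('C(m, 2) * n)%N * (t + (n + 1)%N%:R * a)
          * b ^+ (m * n ^ 2 + 2 * n)%N,
      forall n : nat, (1 <= n)%N ->
        D1 f t (m * n - 1)%N
        = - (-1) ^+ ('C(m, 2) * n)%N * (t + n%:R * a)
          * b ^+ (m * n ^ 2 - 2 * n)%N
    & forall N : nat,
        (forall n : nat, N <> (m * n)%N) ->
        (forall n : nat, N <> (m * n + 1)%N) ->
        (forall n : nat, (1 <= n)%N -> N <> (m * n - 1)%N) ->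
        D1 f t N = 0].
Proof.
have m0 : (0 < m)%N by lia.
split=> [n | n | [//|n] _ | N N0 N1 N2].
- by rewrite exprM (D1_mul _ _ _ _ m0 hf hm).
- by rewrite exprM (D1_mul_add1 _ _ _ _ m0 hf hm).
- have -> : (m * n.+1 - 1 = m * n + (m - 1))%N by nia.
  by rewrite exprM (D1_mul_sub1 _ _ _ _ m0 hf hm).
rewrite (divn_eq N m) mulnC (D1_eq0 _ _ _ _ m0 hf hm) //.
have rm := ltn_pmod N m0; have NE := divn_eq N m.
(* The exclusions rule out the residues 0, 1 and m - 1; the last needs the quotient plus one, as mq
   + (m - 1) = m(q + 1) - 1. *)
have := N0 (N %/ m)%N; have := N1 (N %/ m)%N; have := N2 (N %/ m).+1 isT.
by nia.
Qed.
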